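(* Let $G=(V,E)$ be a graph on $n=|V|$ vertices with Laplacian matrix $L$, and let $\lambda_{\max}(L)$ be the largest eigenvalue of $L$. Then the chromatic number $\chi(G)$ satisfies $$\chi(G)\ \ge\ 1+\frac{2|E|}{n\,\lambda_{\max}(L)-2|E|}.$$
   Context: Graphs are finite, simple and undirected. If $A$ is the adjacency matrix of $G$ and $u_n$ is the all-ones vector of length $n$, the Laplacian matrix is $L=\operatorname{Diag}(Au_n)-A$, where $\operatorname{Diag}(v)$ is the diagonal matrix with diagonal $v$. The chromatic number $\chi(G)$ is the smallest number of colors needed to color the vertices of $G$ so that no two adjacent vertices have the same color. *)

(* Defs.v *)
From HB Require Import structures.
From mathcomp Require Import all_boot all_order all_algebra.
From mathcomp Require Import classical_sets reals.

Set Implicit Arguments.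
Unset Strict Implicit.
Unset Printing Implicit Defensive.

Import Order.TTheory GRing.Theory Num.Theory.
Local Open Scope ring_scope.

Record sgraph := SGraph {
  vertex :> finType;
  adj : rel vertex;
  adj_sym : symmetric adj;
  adj_irr : irreflexive adj }.

Definition edges (G : sgraph) : {set {set G}} :=
  [set A | [exists x, exists y, adj x y && (A == [set x; y])]].

Definition proper_coloring (G : sgraph) (k : nat) (c : {ffun G -> 'I_k}) :=
  [forall x, forall y, adj x y ==> (c x != c y)].

Definition colorable (G : sgraph) (k : nat) :=
  [exists c : {ffun G -> 'I_k}, proper_coloring c].

Lemma colorable_ex (G : sgraph) : exists k, colorable G k.
Proof.
exists #|G|; apply/existsP; exists [ffun x => enum_rank x].
apply/forallP=> x; apply/forallP=> y; apply/implyP=> xy.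
rewrite !ffunE (inj_eq enum_rank_inj).
by apply: contraTneq xy => ->; rewrite adj_irr.
Qed.

Definition chromatic_number (G : sgraph) : nat := ex_minn (colorable_ex G).

(* Row and column i correspond to the i-th vertex of the canonical
   enumeration of G. *)
Definition adjacency (R : realType) (G : sgraph) : 'M[R]_#|G| :=
  \matrix_(i, j) (adj (enum_val i) (enum_val j))%:R.

(* [diag_mx] takes a row vector, hence the transpose. *)
Definition laplacian (R : realType) (G : sgraph) : 'M[R]_#|G| :=
  diag_mx (adjacency R G *m const_mx 1 : 'cV_#|G|)^T - adjacency R G.

(* A matrix has finitely many eigenvalues, so this supremum is attained,
   hence is the largest eigenvalue, as soon as some real eigenvalue exists;
   this is the case for a symmetric matrix of positive size. Mathcomp's
   [eigenvalue] refers to row eigenvectors, which makes no difference to the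
   set of eigenvalues. For a matrix without real eigenvalues the value is 0. *)
Definition lambda_max (R : realType) (n : nat) (A : 'M[R]_n) : R :=
  sup [set a : R | eigenvalue A a]%classic.

(* Main.v *)
(* Let c be a proper colouring of G with k colours and, for a colour j, let
   x_j be the vector equal to k - 1 on the class of j and to -1 elsewhere.
   Then the sum over j of x_j L x_j^T is 2 k^2 |E|, while the sum of the
   |x_j|^2 is n k (k - 1).  Since x L x^T <= lambda_max(L) |x|^2, this gives
   2 k |E| <= lambda_max(L) n (k - 1), which rearranges to the bound.
   The Rayleigh inequality is read off a unitary diagonalisation of L over
   R[i], whose eigenvalues are real and hence eigenvalues over R. *)
Require Import Defs.
From mathcomp Require Import all_boot all_order all_algebra.
From mathcomp Require Import classical_sets reals.
From mathcomp Require Import spectral sesquilinear complex polyrcf.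
From mathcomp Require Import ring lra.

Import Order.TTheory GRing.Theory Num.Theory.
Local Open Scope ring_scope.

(** A supremum bounds its set only if the set is bounded above. Eigenvalues are roots of the
    characteristic polynomial, which is monic and hence nonzero, so its Cauchy bound applies. *)
Lemma ub_le_lambda_max (R : realType) (n : nat) (A : 'M[R]_n) (a : R) :
  eigenvalue A a -> a <= lambda_max A.
Proof.
move=> Aa; apply: ub_le_sup => //; exists (cauchy_bound (char_poly A)) => b /=.
rewrite eigenvalue_root_char => /rootP /cauchy_boundP.
move=> /(_ (monic_neq0 (char_poly_monic A))) /ltW.
exact: le_trans (ler_norm b).
Qed.

Section Rayleigh.
Local Open Scope complex_scope.
Local Open Scope sesquilinear_scope.

Lemma map_complex_realmx (R : rcfType) (m n : nat) (A : 'M[R]_(m, n)) :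
  map_mx (real_complex R) A \is a realmx.
Proof.
apply/mxOverP => i j; rewrite mxE.
by apply/complex_realP; exists (A i j).
Qed.

Lemma rayleigh_le_lambda_max (R : realType) (n : nat) (A : 'M[R]_n)
    (v : 'rV[R]_n) :
  A^T = A -> (v *m A *m v^T) 0 0 <= lambda_max A * (v *m v^T) 0 0.
Proof.
move=> Asym; pose toC := real_complex R.
pose B := map_mx toC A; pose u := map_mx toC v.
have Breal : B \is a realmx by exact: map_complex_realmx.
have Bherm : B \is hermsymmx.
  apply: realsym_hermsym => //; apply/is_hermitianmxP.
  by rewrite expr0 scale1r map_mx_id // /B map_trmx Asym.
have /orthomx_spectralP BE := hermitian_normalmx Bherm.
set P := spectralmx B in BE; set d := spectral_diag B in BE.
have Pu : P \in unitmx by exact: spectral_unit.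
have Pi : invmx P = P^t* by rewrite invmx_unitary ?spectral_unitarymx.
(* Row [i] of [P] is a left eigenvector of [B] for the real number [d 0 i]. The characteristic
   polynomial of [B] is the image of that of [A], so this number is an eigenvalue of [A] over
   [R]. *)
have d_le i : d 0 i <= toC (lambda_max A).
  have /mxOverP/(_ 0 i)/complex_realP[r dr] :=
    hermitian_spectral_diag_real Bherm.
  rewrite -/d in dr; rewrite dr lecR; apply: ub_le_lambda_max.
  rewrite eigenvalue_root_char -(fmorph_root toC) map_char_poly.
  rewrite -eigenvalue_root_char; apply/eigenvalueP; exists (row i P).
    rewrite -/B -row_mul BE !mulmxA mulmxV // mul1mx.
    by apply/rowP => j; rewrite mul_diag_mx !mxE dr.
  apply/eqP => Pi0; have /rowP/(_ i) : row i (P *m invmx P) = 0.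
    by rewrite row_mul Pi0 mul0mx.
  by rewrite mulmxV // !mxE eqxx => /eqP; rewrite oner_eq0.
have uT : map_mx toC v^T = u^t*.
  by rewrite /u map_trmx realmxC //; exact: map_complex_realmx.
(* Coordinates of [u] in the orthonormal basis of rows of [P]. In them both sides are sums of the
   squared moduli of the entries of [w], with weights [d 0 i] and [lambda_max A], and compare term
   by term. *)
pose w := u *m P^t*.
have wT : w^t* = P *m u^t* by rewrite /w trmx_mul map_mxM trmxCK.
suff : toC ((v *m A *m v^T) 0 0) <= toC (lambda_max A * (v *m v^T) 0 0).
  by rewrite lecR.
have -> : toC ((v *m A *m v^T) 0 0) = (w *m diag_mx d *m w^t*) 0 0.
  transitivity ((u *m B *m u^t*) 0 0); last by rewrite wT {1}BE Pi !mulmxA.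
  by rewrite -uT -!map_mxM [RHS]mxE.
have -> : toC (lambda_max A * (v *m v^T) 0 0) =
          toC (lambda_max A) * (w *m w^t*) 0 0.
  rewrite [LHS](rmorphM (real_complex R)); congr (_ * _).
  transitivity ((u *m u^t*) 0 0); first by rewrite -uT -!map_mxM [RHS]mxE.
  by rewrite wT /w -Pi mulmxA mulmxKV.
rewrite !mxE mulr_sumr; apply: ler_sum => i _.
rewrite mul_mx_diag !mxE [X in X * _]mulrC -mulrA.
by apply: ler_wpM2r; [exact: mul_conjC_ge0 | exact: d_le].
Qed.

End Rayleigh.

(** Sending an ordered adjacent pair to its unordered pair is two-to-one onto the edges: the fibre
    of an edge is (x, y) and (y, x), distinct by irreflexivity. *)
Lemma card_adj_edges (G : sgraph) :
  (\sum_(p : G * G) adj p.1 p.2 = 2 * #|edges G|)%N.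
Proof.
rewrite -big_mkcond /=.
rewrite (partition_big (fun p => [set p.1; p.2]) (mem (edges G))).
  rewrite mulnC -sum_nat_const; apply: eq_bigr => A.
  rewrite !inE => /existsP[x /existsP[y /andP[xy /eqP->]]].
  have neq_xy : x != y by apply: contraTneq xy => ->; rewrite adj_irr.
  rewrite sum1_card; transitivity #|[set (x, y); (y, x)]|; last first.
    by rewrite cards2 xpair_eqE negb_and neq_xy.
  apply: eq_card => -[a b]; rewrite !inE !xpair_eqE /=; apply/idP/idP.
    move=> /andP[ab /eqP eq_ab].
    have : a != b by apply: contraTneq ab => ->; rewrite adj_irr.
    have := set21 a b; have := set22 a b; rewrite eq_ab !inE.
    by move=> /orP[]/eqP-> /orP[]/eqP->; rewrite ?eqxx ?orbT.
  by move=> /orP[] /andP[/eqP-> /eqP->]; rewrite unfold_in /=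
    ?[adj y x]adj_sym xy ?eqxx // finset.setUC eqxx.
move=> [x y] /= xy; rewrite !inE.
by apply/existsP; exists x; apply/existsP; exists y; rewrite xy /=.
Qed.

Lemma laplacian_sym (R : realType) (G : sgraph) :
  (laplacian R G)^T = laplacian R G.
Proof.
rewrite /laplacian linearB /= tr_diag_mx; congr (_ - _).
by apply/matrixP => i j; rewrite !mxE adj_sym.
Qed.

(** The degree of [i] is a row sum of the adjacency matrix, so both parts of the Laplacian give
    double sums with the same weights. Half the sum of squared differences would be the usual form;
    this one avoids the factor 1/2. *)
Lemma laplacian_form (R : realType) (G : sgraph) (x : 'rV[R]_#|G|) :
  (x *m laplacian R G *m x^T) 0 0 =
  \sum_i \sum_j adjacency R G i j * (x 0 i * (x 0 i - x 0 j)).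
Proof.
rewrite /laplacian mulmxBr mulmxBl; set A := adjacency R G.
rewrite [LHS]mxE [X in _ + X]mxE [X in X - _]mxE [X in _ - X]mxE.
transitivity (\sum_i \sum_j A i j * x 0 i * x 0 i
              - \sum_i \sum_j A i j * x 0 i * x 0 j).
  congr (_ - _).
    apply: eq_bigr => i _; rewrite mul_mx_diag !mxE mulr_sumr mulr_suml.
    by apply: eq_bigr => j _; rewrite !mxE; ring.
  rewrite exchange_big; apply: eq_bigr => j _; rewrite !mxE mulr_suml.
  by apply: eq_bigr => i _; ring.
rewrite -sumrB; apply: eq_bigr => i _; rewrite -sumrB.
by apply: eq_bigr => j _; ring.
Qed.

Lemma sum_adjacency (R : realType) (G : sgraph) :
  \sum_i \sum_j adjacency R G i j = 2 * #|edges G|%:R.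
Proof.
rewrite -natrM -card_adj_edges natr_sum.
rewrite -(pair_bigA _ (fun x y : G => (adj x y : nat)%:R)) /=.
rewrite [RHS](reindex _ (onW_bij _ (@enum_val_bij G))); apply: eq_bigr => i _.
rewrite [RHS](reindex _ (onW_bij _ (@enum_val_bij G))); apply: eq_bigr => j _.
by rewrite mxE.
Qed.

Lemma sum_indicator (R : pzSemiRingType) (T : finType) (a : T) :
  \sum_j (a == j)%:R = 1 :> R.
Proof.
by rewrite (bigD1 a) //= eqxx big1 ?addr0 // => j /negbTE; rewrite eq_sym => ->.
Qed.

Lemma edges_le_coloring (R : realType) (G : sgraph) (k : nat) :
  colorable G k ->
  k%:R ^+ 2 * (2 * #|edges G|%:R) <=
    lambda_max (laplacian R G) * (#|G|%:R * (k%:R * (k%:R - 1))) :> R.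
Proof.
move=> /existsP[c /forallP c_proper].
pose col (i : 'I_#|G|) : 'I_k := c (enum_val i); pose K : R := k%:R.
pose x j : 'rV[R]_#|G| := \row_i (K * (col i == j)%:R - 1).
have card_col : \sum_(j < k) (1 : R) = K.
  by rewrite sumr_const card_ord.
have -> : K ^+ 2 * (2 * #|edges G|%:R) =
    \sum_j (x j *m laplacian R G *m (x j)^T) 0 0.
  (* With the sum over colours moved innermost, it suffices that each ordered adjacent pair
     contributes [K ^+ 2]. *)
  under [RHS]eq_bigr do rewrite laplacian_form.
  rewrite exchange_big -sum_adjacency mulr_sumr; apply: eq_bigr => i _.
  rewrite exchange_big mulr_sumr; apply: eq_bigr => l _ /=.
  rewrite -mulr_sumr mxE; case: (boolP (adj _ _)) => [il|_]; last first.
    by rewrite mulr0 mul0r.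
  rewrite mulr1 mul1r.
  have neq_c : col i != col l.
    by have /forallP/(_ (enum_val l))/implyP/(_ il) := c_proper (enum_val i).
  (* Only two colours count: that of [i] gives (K - 1) K and that of [l] gives (-1)(-K). They differ
     since the colouring is proper. *)
  transitivity (\sum_j (K * (K - 1) * (col i == j)%:R + K * (col l == j)%:R)).
    by rewrite big_split /= -!mulr_sumr !sum_indicator; ring.
  apply: eq_bigr => j _; rewrite !mxE.
  case: (col i =P j) => [ij|_]; case: (col l =P j) => [lj|_] /=; try ring.
  by rewrite ij lj eqxx in neq_c.
have -> : #|G|%:R * (K * (K - 1)) = \sum_j (x j *m (x j)^T) 0 0.
  under [RHS]eq_bigr do rewrite mxE.
  rewrite exchange_big /=.
  have -> : #|G|%:R = \sum_(i < #|G|) 1 :> R by rewrite sumr_const card_ord.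
  rewrite mulr_suml; apply: eq_bigr => i _; rewrite mul1r.
  (* The squared entry is 1, except at the colour of [i], where it is (K - 1)^2 = K (K - 2) + 1. *)
  transitivity (\sum_j (K * (K - 2) * (col i == j)%:R + 1)).
    by rewrite big_split /= -mulr_sumr sum_indicator card_col; ring.
  by apply: eq_bigr => j _; rewrite !mxE; case: (_ == j) => /=; ring.
rewrite mulr_sumr; apply: ler_sum => j _.
exact/rayleigh_le_lambda_max/laplacian_sym.
Qed.

Theorem theorem5 (R : realType) (G : sgraph) (G_gt0 : (0 < #|G|)%N) :
  (chromatic_number G)%:R >=
    1 + 2 * #|edges G|%:R /
        (#|G|%:R * lambda_max (laplacian R G) - 2 * #|edges G|%:R) :> R.
Proof.
rewrite /chromatic_number; case: ex_minnP => k k_col _.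
(* A vertex exists, so its colour does too; this allows cancelling a factor [K] below. *)
have k_ge1 : 1 <= k%:R :> R.
  case/existsP: k_col => c _; case/card_gt0P: G_gt0 => v _.
  by rewrite ler1n (leq_ltn_trans _ (ltn_ord (c v))).
have := edges_le_coloring R G k k_col.
set E : R := 2 * #|edges G|%:R; set lam := lambda_max _.
set n : R := #|G|%:R; set K : R := k%:R in k_ge1 *.
have E_ge0 : 0 <= E by rewrite mulr_ge0.
move=> le_E; have {}le_E : K * E <= lam * n * (K - 1).
  rewrite -(ler_pM2l (lt_le_trans ltr01 k_ge1)).
  have -> : K * (K * E) = K ^+ 2 * E by ring.
  by apply: le_trans le_E _; rewrite le_eqVlt; apply/predU1P; left; ring.
rewrite addrC -lerBrDr.
(* For a positive denominator, clearing it gives [le_E] rearranged. Otherwise the quotient is at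
   most 0, hence at most K - 1; this includes a zero denominator, as for edgeless graphs, where the
   inverse of 0 is 0. *)
have [D_gt0|D_le0] := ltrP 0 (n * lam - E).
  by rewrite ler_pdivrMr //; nra.
apply: (@le_trans _ _ 0); last lra.
by rewrite mulr_ge0_le0 // invr_le0.
Qed.
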